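(* Let $d \ge 2$ and $r \ge 1$ be integers, and put $F_d(r) := (2^{d+3}r)^{2d}$ and $G_d(r) := (2^{d+3}r)^{2d^2}$. Let $K$ be an arbitrary field, let $n_1,\dots,n_d$ be positive integers, and let $T \in K^{n_1}\otimes\cdots\otimes K^{n_d}$. Suppose that every subtensor $T[X_1,\dots,X_d]$ with $X_i \subseteq [n_i]$ and $|X_i| = F_d(r)$ for all $i$ has partition rank at most $r$. Then $T$ has partition rank at most $G_d(r)$. *)

(* Defs.v *)
From HB Require Import structures.
From mathcomp Require Import all_boot all_order all_algebra.
Set Implicit Arguments. Unset Strict Implicit. Unset Printing Implicit Defensive.
Import GRing.Theory.
Local Open Scope ring_scope.

(* A d-dimensional tensor over K with coordinate index types I 0, ..., I (d-1)
   is a function from the product (forall i, I i) to K.  For the paper's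
   K^{n_1} (x) ... (x) K^{n_d} we take I i = 'I_(n i). *)
Definition tensor (K : fieldType) (d : nat) (I : 'I_d -> Type) :=
  (forall i : 'I_d, I i) -> K.

Definition depends_only_on (K : fieldType) (d : nat) (I : 'I_d -> Type)
  (S : {set 'I_d}) (f : tensor K I) : Prop :=
  forall x y : forall i, I i, (forall i, i \in S -> x i = y i) -> f x = f y.

Definition prk_one (K : fieldType) (d : nat) (I : 'I_d -> Type)
  (t : tensor K I) : Prop :=
  exists S : {set 'I_d}, [/\ S != set0, S != setT &
    exists a b : tensor K I,
      [/\ depends_only_on S a, depends_only_on (~: S) b &
          forall x, t x = a x * b x]].

Definition prk_le (K : fieldType) (d : nat) (I : 'I_d -> Type)
  (T : tensor K I) (r : nat) : Prop :=
  exists f : 'I_r -> tensor K I,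
    (forall j, prk_one (f j)) /\ forall x, T x = \sum_(j < r) f j x.

Definition subtensor (K : fieldType) (d : nat) (n : 'I_d -> nat)
  (T : tensor K (fun i => 'I_(n i))) (X : forall i : 'I_d, {set 'I_(n i)}) :
  tensor K (fun i => {x : 'I_(n i) | x \in X i}) :=
  fun y => T (fun i => sval (y i)).

Definition Fd (d r : nat) : nat := (2 ^ (d + 3) * r) ^ (2 * d).
Definition Gd (d r : nat) : nat := (2 ^ (d + 3) * r) ^ (2 * d ^ 2).

(* Main.v *)
Require Import Defs.
From HB Require Import structures.
From mathcomp Require Import all_boot all_order all_algebra.
From mathcomp Require Import perm.
From Stdlib Require Import Classical FunctionalExtensionality.
Set Implicit Arguments. Unset Strict Implicit. Unset Printing Implicit Defensive.
Import GRing.Theory.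
Local Open Scope ring_scope.

(** Let m = F_d(r).  To an array s of d injections s_i : [m] -> [m] with s_{i0}
    the identity, associate the monomial prod_j T(u_{s_i(j)}(i))_i in the entries
    of T at a family u_1, ..., u_m of index tuples.  For every T of partition
    rank at most r it expands, over colourings k of [m] by the rank-one terms,
    into products that only depend on a signature of (k, s).  A signature is
    shared by all the arrays obtained by permuting one factor within the colour
    classes, so there are fewer signatures than arrays as soon as
    (2^d r)^(2m) < m!, and linear algebra over K gives a nonzero combination c of
    the monomials that vanishes on every T of partition rank at most r, hence on
    every m x ... x m subtensor under consideration.

    Fix s0 with c(s0) <> 0, and let f_q be the part of the form given by the
    arrays that agree with s0 on all j >= q, with the factors j >= q removed.
    Then f_m vanishes identically and f_0 = c(s0), so some f_{q+1} vanishes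
    identically while f_q(u) <> 0.  Placing a variable point x at the indices
    s0_i(q) of u, f_{q+1} = 0 expresses T(x) f_q(u) as a sum over v <> (s0_i(q))_i
    in [m]^d of terms T(..) * (..) whose two factors depend on disjoint sets of
    coordinates of x; hence the bound m^d = G_d(r). *)

(** * Counting and linear algebra *)

Lemma expnn_le_fact_sqr (m : nat) : (m ^ m <= m`! ^ 2)%N.
Proof.
(* Pair the factor j + 1 of one factorial with m - j of the other; each product is at least m. *)
have -> : (m`! ^ 2 = \prod_(j < m) (j.+1 * (m - j)))%N.
  rewrite big_split /= -ffact_prod ffactnn; congr (_ * _)%N.
  by rewrite fact_prod big_add1 big_mkord.
rewrite -[X in (_ ^ X)%N]card_ord -prod_nat_const.
apply: leq_prod => j _; have lt_jm := ltn_ord j.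
rewrite -{1}(subnKC (ltnW lt_jm)) mulSn addnC leq_add2l.
by rewrite leq_pmulr // subn_gt0.
Qed.

Lemma card_imset_fiber (X Y : finType) (A : {set X}) (e : X -> Y) (h : nat) :
  (forall x, x \in A -> h <= #|[set z in A | e z == e x]|)%N ->
  (#|e @: A| * h <= #|A|)%N.
Proof.
move=> fibh; rewrite -[X in (_ <= X)%N]sum1_card (partition_big_imset e) /=.
rewrite -sum_nat_const; apply: leq_sum => _ /imsetP[x Ax ->].
by apply: leq_trans (fibh x Ax) _; rewrite -sum1dep_card.
Qed.

(** A matrix with more rows than columns has a nonzero left kernel vector. *)
Lemma left_kernel_neq0 (K : fieldType) (X Y : finType) (A : {set X})
    (E : {set Y}) (M : X -> Y -> K) :
  (#|E| < #|A|)%N ->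
  exists c : X -> K, (exists2 x, x \in A & c x != 0) /\
    forall y, y \in E -> \sum_(x in A) c x * M x y = 0.
Proof.
move=> ltEA.
pose N : 'M[K]_(#|A|, #|E|) := \matrix_(p, q) M (enum_val p) (enum_val q).
have : kermx N != 0.
  rewrite kermx_eq0 /row_free neq_ltn; apply/orP; left.
  exact: leq_ltn_trans (rank_leq_col N) ltEA.
case/rowV0Pn => v /sub_kermxP vN0 vn0.
have [p vp] : exists p, v 0 p != 0.
  by case/matrix0Pn: vn0 => i [p]; rewrite ord1; exists p.
have Ap := enum_valP p.
pose c x := v 0 (enum_rank_in Ap x).
exists c; split.
  by exists (enum_val p) => //; rewrite /c enum_valK_in.
move=> y Ey; have := congr1 (fun W : 'rV_ _ => W 0 (enum_rank_in Ey y)) vN0.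
rewrite !mxE => vN0y; rewrite -[RHS]vN0y.
rewrite (big_enum_rank Ap (fun q => v 0 q * N q (enum_rank_in Ey y))) /=.
by apply: eq_bigr => x Ax; rewrite !mxE !enum_rankK_in.
Qed.

(** * Signatures and the vanishing form *)

Section Twisting.

Variables (d m : nat) (L : finType) (B : L -> {set 'I_d}) (i0 : 'I_d).
Hypothesis i0B : forall l, i0 \notin B l.
Hypothesis Bn0 : forall l, B l != set0.
Variable j0 : 'I_m.

Local Notation arr := {ffun 'I_d -> {ffun 'I_m -> 'I_m}}.

Definition arrangements : {set arr} :=
  [set s : arr | [forall i, injectiveb (s i)] && [forall j, s i0 j == j]].

Lemma arrangementsP (s : arr) :
  reflect ((forall i, injective (s i)) /\ forall j, s i0 j = j)
          (s \in arrangements).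
Proof.
rewrite inE; apply: (iffP andP) => [[/forallP s_inj /forallP s0]|[s_inj s0]].
  by split=> [i|j]; [apply/injectiveP | apply/eqP].
by split; apply/forallP => i; [apply/injectiveP | apply/eqP].
Qed.

(* For a rank-one term of colour l, [B l] is the set of coordinates read by its
   second factor; [idxB] and [idxC] record the indices read by the second and
   the first factor of the colour of [j], with [j0] as a filler elsewhere. *)
Definition idxB (k : {ffun 'I_m -> L}) (s : arr) (j : 'I_m) :
    L * {ffun 'I_d -> 'I_m} :=
  (k j, [ffun i => if i \in B (k j) then s i j else j0]).

Definition idxC (k : {ffun 'I_m -> L}) (s : arr) (j : 'I_m) :
    L * {ffun 'I_d -> 'I_m} :=
  (k j, [ffun i => if i \in B (k j) then j0 else s i j]).

(* Since s i0 is the identity, the first factors can be listed by j, whereas the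
   second factors are recorded as a set, which is what makes [signature]
   invariant under [twist]. *)
Definition signature (k : {ffun 'I_m -> L}) (s : arr) :=
  ([ffun j => idxC k s j], [set idxB k s j | j : 'I_m]).

Lemma idxB_inj k s : s \in arrangements -> injective (idxB k s).
Proof.
case/arrangementsP => s_inj _ j j' [kjj' /ffunP eqB].
have /set0Pn[i iB] := Bn0 (k j); have := eqB i.
by rewrite !ffunE -kjj' iB => /s_inj.
Qed.

Definition colour_stab (k : {ffun 'I_m -> L}) : {set 'S_m} :=
  [set t : 'S_m | [forall j, k (t j) == k j]].

(** The nonempty fibres of the map sending [t] to the colouring [k (t j)] are cosets of the
    stabiliser, and there are at most |L|^m of them. *)
Lemma fact_le_colour_stab k : (m`! <= #|L| ^ m * #|colour_stab k|)%N.
Proof.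
rewrite -card_Sn -[leqLHS]sum1_card.
pose F (t : 'S_m) := [ffun j => k (t j)].
rewrite (partition_big F xpredT) //=.
have -> : (#|L| ^ m = #|{ffun 'I_m -> L}|)%N by rewrite card_ffun card_ord.
rewrite -sum_nat_const; apply: leq_sum => w _; rewrite sum1dep_card.
have [->|[t0]] := set_0Vmem [set t | F t == w]; first by rewrite cards0.
rewrite inE => /eqP Ft0.
rewrite -(card_imset _ (mulgI t0^-1%g)); apply/subset_leq_card/subsetP => t'.
case/imsetP => t; rewrite inE => /eqP Ft ->; rewrite inE.
apply/forallP => j; rewrite permM.
have /ffunP/(_ ((t0^-1)%g j)) := etrans Ft (esym Ft0).
by rewrite !ffunE permKV => ->.
Qed.

Definition twist (k : {ffun 'I_m -> L}) (s : arr) (t : 'S_m) : arr :=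
  [ffun i => [ffun j => if i \in B (k j) then s i (t j) else s i j]].

(** Since [t] preserves colours, a twisted and an untwisted entry of the same row cannot collide.
    Row [i0] lies in no block, so it stays the identity. *)
Lemma twist_arrangement k s t :
  s \in arrangements -> t \in colour_stab k -> twist k s t \in arrangements.
Proof.
case/arrangementsP => s_inj s0; rewrite inE => /forallP kt.
apply/arrangementsP; split=> [i j j'|j]; last first.
  by rewrite !ffunE (negPf (i0B _)) s0.
rewrite !ffunE; case: ifP => iBj; case: ifP => iBj' /s_inj.
- exact: perm_inj.
- by move=> jj'; rewrite -jj' (eqP (kt j)) iBj in iBj'.
- by move=> jj'; rewrite jj' (eqP (kt j')) iBj' in iBj.
- by [].
Qed.

Lemma signature_twist k s t :
  t \in colour_stab k -> signature k (twist k s t) = signature k s.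
Proof.
rewrite inE => /forallP kt; congr (_, _).
  apply/ffunP => j; rewrite !ffunE; congr (_, _).
  by apply/ffunP => i; rewrite !ffunE; case: (i \in B _).
have idxE j : idxB k (twist k s t) j = idxB k s (t j).
  rewrite /idxB (eqP (kt j)); congr (_, _).
  by apply/ffunP => i; rewrite !ffunE; case: (i \in B _).
apply/setP => p; apply/imsetP/imsetP => -[j _ ->].
  by exists (t j).
by exists ((t^-1)%g j); rewrite ?idxE ?permKV.
Qed.

Lemma twist_inj k s : s \in arrangements -> injective (twist k s).
Proof.
case/arrangementsP => s_inj _ t t' eqt; apply/permP => j.
have /set0Pn[i iB] := Bn0 (k j).
have := congr1 (fun z : arr => z i j) eqt.
by rewrite !ffunE iB => /s_inj.
Qed.

(** The twists of [s] by [colour_stab k] are distinct and share its signature, so each fibre has at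
    least m!/|L|^m elements. *)
Lemma card_signatures k :
  (#|signature k @: arrangements| * m`! <= #|L| ^ m * #|arrangements|)%N.
Proof.
apply: leq_trans (_ : _ <= #|L| ^ m * (#|signature k @: arrangements| *
  #|colour_stab k|))%N _; last first.
  rewrite leq_mul2l; apply/orP; right.
  apply: card_imset_fiber => s As.
  rewrite -(card_imset _ (@twist_inj k _ As)).
  apply/subset_leq_card/subsetP => s'; case/imsetP => t kt ->.
  by rewrite inE twist_arrangement // signature_twist // eqxx.
by rewrite mulnCA leq_mul2l fact_le_colour_stab orbT.
Qed.

Definition all_signatures := \bigcup_k (signature k @: arrangements).

Lemma card_all_signatures :
  (#|L| ^ (2 * m) < m`!)%N -> (#|all_signatures| < #|arrangements|)%N.
Proof.
move=> ltLm; have A0 : (0 < #|arrangements|)%N.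
  apply/card_gt0P; exists [ffun _ => [ffun j => j]].
  by apply/arrangementsP; split=> [i j j'|j]; rewrite !ffunE.
rewrite -(ltn_pmul2r (fact_gt0 m)).
apply: leq_ltn_trans (_ : _ <= #|L| ^ (2 * m) * #|arrangements|)%N _; last first.
  by rewrite mulnC ltn_pmul2l.
apply: (@leq_trans ((\sum_k #|signature k @: arrangements|) * m`!)%N).
  rewrite leq_mul2r; apply/orP; right; rewrite /all_signatures.
  elim/big_ind2: _ => [|X1 n1 X2 n2 le1 le2|//]; first by rewrite cards0.
  by apply: leq_trans (leq_card_setU _ _) (leq_add le1 le2).
rewrite big_distrl /=.
apply: leq_trans (leq_sum _ (fun k _ => card_signatures k)) _.
by rewrite sum_nat_const card_ffun card_ord mulnA -expnD addnn mul2n.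
Qed.

(** The coefficients [c] are fixed before the index types, [T] and [u], so that one form serves all
    subtensors at once. *)
Lemma vanishing_form (K : fieldType) :
  (#|L| ^ (2 * m) < m`!)%N ->
  exists c : arr -> K, (exists2 s, s \in arrangements & c s != 0) /\
  forall (I : 'I_d -> Type) (T : tensor K I) (a b : L -> tensor K I),
    (forall l, depends_only_on (B l) (b l)) ->
    (forall l, depends_only_on (~: B l) (a l)) ->
    (forall x, T x = \sum_l a l x * b l x) ->
    forall u : 'I_m -> forall i, I i,
    \sum_(s in arrangements) c s * \prod_j T (fun i => u (s i j) i) = 0.
Proof.
move=> /card_all_signatures lt_sig.
(* The number, read in [K], of colourings giving [s] the signature [y]: the coefficient of [val y]
   below in the monomial of [s]. *)
pose M s y : K := \sum_k (signature k s == y)%:R.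
have [c [c_n0 cM]] := left_kernel_neq0 M lt_sig.
exists c; split=> // I T a b depb depa TE u.
pose val (y : {ffun 'I_m -> L * {ffun 'I_d -> 'I_m}} *
              {set L * {ffun 'I_d -> 'I_m}}) : K :=
  (\prod_j a (y.1 j).1 (fun i => u ((y.1 j).2 i) i)) *
  \prod_(p in y.2) b p.1 (fun i => u (p.2 i) i).
have prodE s : s \in arrangements ->
    \prod_j T (fun i => u (s i j) i) = \sum_(y in all_signatures) M s y * val y.
  move=> As; under eq_bigr do rewrite TE.
  rewrite bigA_distr_bigA /=.
  under [RHS]eq_bigr do rewrite big_distrl /=.
  rewrite exchange_big /=; apply: eq_bigr => k _.
  have sig_in : signature k s \in all_signatures.
    by apply/bigcupP; exists k => //; apply: imset_f.
  rewrite (bigD1 (signature k s)) //= eqxx mul1r.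
  rewrite [X in _ = _ + X]big1 ?addr0; last first.
    by move=> y /andP[_ ny]; rewrite eq_sym (negPf ny) mul0r.
  rewrite big_split /=; congr (_ * _).
    apply: eq_bigr => j _; rewrite ffunE /=; apply: depa => i.
    by rewrite inE ffunE => /negPf ->.
  rewrite big_imset /=; last by move=> j j' _ _; apply: idxB_inj.
  apply: eq_big => // j _; apply: depb => i iB.
  by rewrite ffunE iB.
under eq_bigr => s As do rewrite prodE // big_distrr.
rewrite exchange_big /= big1 // => y Ey.
under eq_bigr do rewrite mulrA.
by rewrite -big_distrl /= cM // mul0r.
Qed.

End Twisting.

(** * Partition rank of finite sums *)

Lemma prk_one0 (K : fieldType) (d : nat) (I : 'I_d -> Type)
    (t : tensor K I) :
  (1 < d)%N -> (forall x, t x = 0) -> prk_one t.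
Proof.
move=> d_gt1 t0; exists [set Ordinal (ltnW d_gt1)]; split.
- by apply/set0Pn; exists (Ordinal (ltnW d_gt1)); rewrite inE.
- by apply/eqP => /setP/(_ (Ordinal d_gt1)); rewrite !inE.
by exists (fun=> 0), (fun=> 0); split=> // x; rewrite t0 mulr0.
Qed.

Lemma prk_le_sum (K : fieldType) (d : nat) (I : 'I_d -> Type)
    (T : tensor K I) (J : finType) (g : J -> tensor K I) (r : nat) :
  (1 < d)%N -> (#|J| <= r)%N -> (forall j, prk_one (g j)) ->
  (forall x, T x = \sum_j g j x) -> prk_le T r.
Proof.
move=> d_gt1 leJr g1 TE.
pose f (j : 'I_r) := if insub (j : nat) is Some q
  then g (enum_val (q : 'I_#|J|)) else fun=> 0.
exists f; split=> [j|x].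
  by rewrite /f; case: insubP => *; [exact: g1 | exact: prk_one0].
rewrite TE (reindex _ (onW_bij _ (@enum_val_bij J))) /=.
transitivity (\sum_(q < #|J|) if insub (q : nat) is Some q'
    then g (enum_val (q' : 'I_#|J|)) x else 0).
  by apply: eq_bigr => q _; rewrite valK.
rewrite (big_ord_widen r (fun q => if insub q is Some q'
    then g (enum_val (q' : 'I_#|J|)) x else 0)) // big_mkcond.
by apply: eq_bigr => j _; rewrite /f; case: insubP => [q -> _|/negPf ->].
Qed.

(** * Descent to a pivot *)

Section Descent.

Variables (K : fieldType) (d m : nat) (I : 'I_d -> Type) (T : tensor K I).
Variable i0 : 'I_d.
Hypothesis d_gt1 : (1 < d)%N.

Local Notation arr := {ffun 'I_d -> {ffun 'I_m -> 'I_m}}.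

Variables (c : arr -> K) (s0 : arr).
Hypothesis s0_arr : s0 \in arrangements m i0.

Definition agree_from (q : nat) (s : arr) : bool :=
  [forall j : 'I_m, (q <= j)%N ==> [forall i, s i j == s0 i j]].

Lemma agree_fromP q (s : arr) :
  reflect (forall j : 'I_m, (q <= j)%N -> forall i, s i j = s0 i j)
          (agree_from q s).
Proof.
apply: (iffP forallP) => [ag j qj i|ag j].
  by have /implyP/(_ qj)/forallP/(_ i)/eqP := ag j.
by apply/implyP => qj; apply/forallP => i; rewrite ag.
Qed.

Definition partial_form (q : nat) (u : 'I_m -> forall i, I i) : K :=
  \sum_(s in arrangements m i0 | agree_from q s)
    c s * \prod_(j < m | (j < q)%N) T (fun i => u (s i j) i).

Lemma partial_form0 u : partial_form 0 u = c s0.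
Proof.
rewrite /partial_form (big_pred1 s0) => [|s].
  by rewrite big_pred0 ?mulr1.
apply/andP/eqP => [[_ /agree_fromP ag]|->].
  by apply/ffunP => i; apply/ffunP => j; apply: ag.
by split=> //; apply/agree_fromP.
Qed.

Lemma partial_form_full u :
  partial_form m u =
  \sum_(s in arrangements m i0) c s * \prod_j T (fun i => u (s i j) i).
Proof.
apply: eq_big => [s|s _].
  by rewrite andb_idr // => _; apply/agree_fromP => j; rewrite leqNgt ltn_ord.
by congr (_ * _); apply: eq_bigl => j; rewrite ltn_ord.
Qed.

Lemma prk_le_pivot (q : 'I_m) (u : 'I_m -> forall i, I i) :
  (forall w, partial_form q.+1 w = 0) -> partial_form q u != 0 ->
  prk_le T (m ^ d).
Proof.
move=> fq1_0 fq_n0.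
pose v0 := [ffun i => s0 i q] : {ffun 'I_d -> 'I_m}.
pose ux (x : forall i, I i) (j : 'I_m) i := if j == v0 i then x i else u j i.
pose low (x : forall i, I i) (s : arr) :=
  c s * \prod_(j < m | (j < q)%N) T (fun i => ux x (s i j) i).
pose col (s : arr) := [ffun i => s i q] : {ffun 'I_d -> 'I_m}.
pose P (v : {ffun 'I_d -> 'I_m}) (s : arr) :=
  [&& s \in arrangements m i0, agree_from q.+1 s & col s == v].
pose g (v : {ffun 'I_d -> 'I_m}) x :=
  T (fun i => ux x (v i) i) * \sum_(s | P v s) low x s.
have sum_g x : \sum_v g v x = 0.
  rewrite -[RHS](fq1_0 (ux x)) /partial_form (partition_big col xpredT) //=.
  apply: eq_bigr => v _; rewrite /g big_distrr /=.
  apply: eq_big => [s|s /and3P[_ _ /eqP <-]]; first by rewrite -andbA.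
  rewrite /low mulrCA; congr (_ * _).
  rewrite [RHS](bigD1 q) //=; congr (_ * _).
    by congr (T _); apply: functional_extensionality_dep => i; rewrite ffunE.
  by apply: eq_bigl => j; rewrite ltnS [RHS]andbC -ltn_neqAle.
(* By injectivity of [s i], the factors before [q] avoid the index [v i]. So where [v i = v0 i],
   [low x s] does not read [x i]. *)
have off_pivot s v (j : 'I_m) i : P v s -> (j < q)%N -> s i j != v i.
  move=> /and3P[/arrangementsP[s_inj _] _ /eqP <-] ltjq.
  by rewrite ffunE (inj_eq (s_inj i)) -val_eqE /= ltn_eqF.
have g_v0 x : g v0 x = T x * partial_form q u.
  congr (_ * _).
    by congr (T _); apply: functional_extensionality_dep => i; rewrite /ux eqxx.
  apply: eq_big => [s|s Ps].
    congr (_ && _); apply/andP/agree_fromP => [[/agree_fromP ag /eqP eq_v]|ag].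
      move=> j; rewrite leq_eqVlt => /predU1P[|]; last exact: ag.
      by move/val_inj=> <- i; have /ffunP/(_ i) := eq_v; rewrite !ffunE.
    split; first by apply/agree_fromP => j ltqj; apply/ag/ltnW.
    by apply/eqP/ffunP => i; rewrite !ffunE ag.
  congr (_ * _); apply: eq_bigr => j ltjq; congr (T _).
  apply: functional_extensionality_dep => i.
  by rewrite /ux (negPf (off_pivot _ _ _ _ Ps ltjq)).
apply: (@prk_le_sum _ _ _ _ _ (fun v x => if v == v0 then 0 else
  - (partial_form q u)^-1 * g v x)) => //.
- by rewrite card_ffun !card_ord.
- move=> v; have [_|nv] := eqVneq v v0; first exact: prk_one0.
  (* Row [i0] of every array is the identity, so the sum is empty unless [v i0 = q]; in that case
     [i0] makes the block of the first factor nonempty. *)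
  have [v_i0|nv_i0] := eqVneq (v i0) q; last first.
    apply: prk_one0 => // x; rewrite /g big_pred0 ?mulr0 // => s.
    apply: contraNF nv_i0 => /and3P[/arrangementsP[_ s_i0] _ /eqP <-].
    by rewrite ffunE s_i0.
  have [_ s0_i0] := arrangementsP _ _ s0_arr.
  exists [set i | v i == v0 i]; split.
  + by apply/set0Pn; exists i0; rewrite inE ffunE s0_i0 v_i0.
  + apply: contraNneq nv => /setP eqT; apply/eqP/ffunP => i.
    by apply/eqP; have := eqT i; rewrite !inE.
  exists (fun x => T (fun i => ux x (v i) i)),
    (fun x => - (partial_form q u)^-1 * \sum_(s | P v s) low x s); split.
  + move=> x y eqxy; congr (T _); apply: functional_extensionality_dep => i.
    by rewrite /ux; case: ifP => // vi; apply: eqxy; rewrite inE.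
  + move=> x y eqxy; congr (_ * _); apply: eq_bigr => s Ps; congr (_ * _).
    apply: eq_bigr => j ltjq; congr (T _).
    apply: functional_extensionality_dep => i.
    rewrite /ux; case: eqP => // sij; apply: eqxy; rewrite !inE -sij.
    by rewrite eq_sym off_pivot.
  by move=> x; rewrite mulrCA.
move=> x; have := sum_g x.
rewrite (bigD1 v0) //= g_v0 => /eqP; rewrite addr_eq0 => /eqP TE.
rewrite (bigD1 v0) //= eqxx add0r.
rewrite (eq_bigr (fun v => - (partial_form q u)^-1 * g v x)); last first.
  by move=> v /negPf ->.
by rewrite -big_distrr /= mulNr -mulrN -TE mulrC mulfK.
Qed.

Lemma prk_le_descent (x0 : forall i, I i) :
  c s0 != 0 ->
  (forall u : 'I_m -> forall i, I i,
     \sum_(s in arrangements m i0)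
        c s * \prod_j T (fun i => u (s i j) i) = 0) ->
  prk_le T (m ^ d).
Proof.
(* If the bound failed, no pivot would exist, and vanishing would pass from f_m down to f_0 =
   c(s0). *)
move=> cs0 fm0; apply: NNPP => nprk.
have f0 p : (p <= m)%N -> forall u, partial_form (m - p) u = 0.
  elim: p => [_ u|p IHp ltpm u]; first by rewrite subn0 partial_form_full.
  have lt_q : (m - p.+1 < m)%N by rewrite ltn_subrL (leq_trans _ ltpm).
  apply/eqP; apply: contra_notT nprk => /(@prk_le_pivot (Ordinal lt_q)); apply.
  by rewrite /= subnSK //; apply/IHp/ltnW.
have := f0 m (leqnn m) (fun=> x0).
by rewrite subnn partial_form0; apply/eqP.
Qed.

End Descent.

(** * Slices, subtensors and the final bound *)

Lemma prk_le_slices (K : fieldType) (d : nat) (n : 'I_d -> nat)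
    (T : tensor K (fun i => 'I_(n i))) (i : 'I_d) (r : nat) :
  (1 < d)%N -> (n i <= r)%N -> prk_le T r.
Proof.
move=> d_gt1 leni.
apply: (@prk_le_sum _ _ _ _ 'I_(n i) (fun v x =>
  (x i == v)%:R * T (dfwith x v))) => //; first by rewrite card_ord.
  move=> v; exists [set i]; split.
  - by apply/set0Pn; exists i; rewrite inE.
  - apply/eqP => eqT; have := congr1 (fun A : {set 'I_d} => #|A|) eqT.
    by rewrite cards1 cardsT card_ord => d1; rewrite -d1 in d_gt1.
  exists (fun x => (x i == v)%:R), (fun x => T (dfwith x v)); split=> //.
    by move=> x y eqxy; rewrite eqxy // inE.
  move=> x y eqxy; congr (T _); apply: functional_extensionality_dep => i'.
  case: (eqVneq i i') => [<-|nii']; first by rewrite !dfwith_in.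
  by rewrite !dfwith_out // eqxy // !inE eq_sym.
move=> x; rewrite (bigD1 (x i)) //= eqxx mul1r big1 ?addr0; last first.
  by move=> v nv; rewrite eq_sym (negPf nv) mul0r.
congr (T _); apply: functional_extensionality_dep => i'.
by case: (eqVneq i i') => [<-|nii']; rewrite ?dfwith_in ?dfwith_out.
Qed.

Lemma exists_superset (X : finType) (A : {set X}) (p : nat) :
  (#|A| <= p <= #|X|)%N -> exists2 A' : {set X}, A \subset A' & #|A'| = p.
Proof.
case/andP=> leAp; elim: p leAp => [|p IHp].
  by rewrite leqn0 => /eqP A0 _; exists A.
rewrite leq_eqVlt => /predU1P[Ap _|]; first by exists A.
rewrite ltnS => leAp ltpX; have [A' sAA' cA'] := IHp leAp (ltnW ltpX).
have /set0Pn[x] : ~: A' != set0.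
  by rewrite -card_gt0 cardsCs setCK cA' subn_gt0.
rewrite inE => nA'x; exists (x |: A'); last by rewrite cardsU1 nA'x cA'.
exact: subset_trans sAA' (subsetUr _ _).
Qed.

Lemma prk_le_of_subtensors (d r m : nat) (K : fieldType) (n : 'I_d -> nat)
    (T : tensor K (fun i => 'I_(n i))) :
  (1 < d)%N -> (0 < m)%N -> (forall i, m <= n i)%N ->
  ((r * 2 ^ d) ^ (2 * m) < m`!)%N ->
  (forall X : forall i : 'I_d, {set 'I_(n i)},
      (forall i, #|X i| = m) -> prk_le (@subtensor K d n T X) r) ->
  prk_le T (m ^ d).
Proof.
move=> d_gt1 m_gt0 le_mn lt_m Tr.
pose i0 := Ordinal (ltnW d_gt1); pose j0 := Ordinal m_gt0.
pose proper_block (C : {set 'I_d}) := (i0 \notin C) && (C != set0).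
pose L : finType := ('I_r * {C : {set 'I_d} | proper_block C})%type.
pose B (l : L) := val l.2.
have i0B l : i0 \notin B l by case/andP: (valP l.2).
have Bn0 l : B l != set0 by case/andP: (valP l.2).
have lt_L : (#|L| ^ (2 * m) < m`!)%N.
  apply: leq_ltn_trans lt_m; rewrite leq_exp2r ?muln_gt0 //.
  rewrite card_prod card_ord leq_mul2l card_sig; apply/orP; right.
  apply: leq_trans (max_card _) _.
  by rewrite -cardsT -powersetT card_powerset cardsT card_ord.
have [c [[s0 s0_arr cs0] c_van]] := vanishing_form i0B Bn0 j0 K lt_L.
have x0 i : 'I_(n i) by exists 0%N; apply: leq_trans (le_mn i).
apply: (prk_le_descent d_gt1 s0_arr x0 cs0) => u.
have sup i : exists A' : {set 'I_(n i)},
    [set u j i | j : 'I_m] \subset A' /\ #|A'| = m.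
  have [|A' sA' cA'] := @exists_superset _ [set u j i | j : 'I_m] m.
    by rewrite card_ord le_mn (leq_trans (leq_imset_card _ _)) ?card_ord.
  by exists A'.
have [X XP] := fin_all_exists sup.
have [f [f1 fE]] := Tr X (fun i => proj2 (XP i)).
pose I' i := {x : 'I_(n i) | x \in X i}.
have Xu j i : u j i \in X i.
  by apply: (subsetP (proj1 (XP i))); apply: imset_f.
pose u' j i : I' i := exist _ (u j i) (Xu j i).
(* Factors are swapped if needed, so that the first one reads coordinate [i0]. *)
have split_f (q : 'I_r) : exists C : {C : {set 'I_d} | proper_block C},
    exists a b : tensor K I',
    [/\ depends_only_on (~: val C) a, depends_only_on (val C) b
      & forall x, f q x = a x * b x].
  have [S [Sn0 SnT [a [b [depa depb abE]]]]] := f1 q.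
  have [Si0|nSi0] := boolP (i0 \in S).
    have PC : proper_block (~: S).
      by rewrite /proper_block inE Si0 /= -setCT (inj_eq (@setC_inj _)).
    by exists (exist proper_block _ PC), a, b; rewrite /= setCK.
  have PC : proper_block S by rewrite /proper_block nSi0.
  by exists (exist proper_block _ PC), b, a; split=> // x; rewrite mulrC abE.
have [C CP] := fin_all_exists split_f.
have [a aP] := fin_all_exists CP.
have [b abP] := fin_all_exists aP.
(* Term q is placed at its actual block [C q]; its other colours get zero factors. *)
have := c_van I' (subtensor T (X := X))
  (fun l x => if l.2 == C l.1 then a l.1 x else 0)
  (fun l x => if l.2 == C l.1 then b l.1 x else 0) _ _ _ u'.
apply.
- move=> l x y eqxy; case: eqP => // eC; have [_ depb _] := abP l.1.
  by apply: depb => i; rewrite -eC; apply: eqxy.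
- move=> l x y eqxy; case: eqP => // eC; have [depa _ _] := abP l.1.
  by apply: depa => i; rewrite -eC; apply: eqxy.
move=> x; rewrite fE -(pair_bigA _ (fun q D => (if D == C q then a q x else 0) *
  (if D == C q then b q x else 0))) /=.
apply: eq_bigr => q _; rewrite (bigD1 (C q)) //= eqxx big1 ?addr0.
  by have [_ _ ->] := abP q.
by move=> D /negPf ->; rewrite mul0r.
Qed.

(** With N = 8 * 2^d * r, m^m = N^(2dm) is at least N^(4m) as d >= 2, and N exceeds 2^d * r; compare
    squares. *)
Lemma Fd_fact (d r : nat) :
  (2 <= d)%N -> (1 <= r)%N -> ((r * 2 ^ d) ^ (2 * Fd d r) < (Fd d r)`!)%N.
Proof.
move=> d_ge2 r_gt0; set m := Fd d r; set N := (2 ^ (d + 3) * r)%N.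
have N_gt0 : (0 < N)%N by rewrite muln_gt0 expn_gt0.
have m_gt0 : (0 < m)%N by rewrite expn_gt0 N_gt0.
rewrite -ltn_sqr; apply: leq_trans (expnn_le_fact_sqr m).
rewrite {3}/m /Fd -/N -!expnM.
apply: leq_trans (_ : N ^ (2 * m * 2) <= _)%N; last first.
  by rewrite leq_pexp2l // mulnAC leq_mul2r leq_mul2l d_ge2 !orbT.
rewrite ltn_exp2r ?muln_gt0 ?m_gt0 // /N mulnC ltn_pmul2r //.
by rewrite ltn_exp2l // -addn1 leq_add2l.
Qed.

Theorem theorem1p1 (d r : nat) (K : fieldType) (n : 'I_d -> nat)
  (T : tensor K (fun i => 'I_(n i))) :
  (2 <= d)%N -> (1 <= r)%N -> (forall i, (0 < n i)%N) ->
  (forall X : forall i : 'I_d, {set 'I_(n i)},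
      (forall i, #|X i| = Fd d r) -> prk_le (@subtensor K d n T X) r) ->
  prk_le T (Gd d r).
Proof.
move=> d_ge2 r_gt0 _ Tr.
have F_gt0 : (0 < Fd d r)%N by rewrite !(expn_gt0, muln_gt0) r_gt0.
have -> : Gd d r = (Fd d r ^ d)%N by rewrite /Gd /Fd -expnM -mulnA mulnn.
have [le_Fn|/forallPn[i]] := boolP [forall i, Fd d r <= n i]%N.
  by apply: prk_le_of_subtensors Tr => //; [apply/forallP | apply: Fd_fact].
(* A side shorter than F_d(r) is handled by slicing along it. *)
rewrite -ltnNge => /ltnW le_nF; apply: (prk_le_slices T d_ge2 (i := i)).
apply: leq_trans le_nF _; rewrite -[leqLHS]expn1 leq_pexp2l //.
exact: ltnW.
Qed.
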